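(* Let $\alpha:I\to\mathbb{S}^3$ and $\beta:J\to\mathbb{S}^3$ be smooth curves parametrized by arc length and let $X:I\times J\to\mathbb{S}^3$, $X(s,t)=\alpha(s)\cdot\beta(t)$, be a parametrization of a translation surface. Then the regularity condition (the condition for $X$ to be a regular parametrization) is $\langle T_\alpha,T_\beta\rangle\neq\pm1$. The unit normal field of $X$ in $\mathbb{S}^3$ at $X(s,t)$ is $$N(s,t)=\frac{\alpha'(s)\cdot\beta'(t)-\langle T_\alpha(s),T_\beta(t)\rangle\,\alpha(s)\cdot\beta(t)}{\sqrt{1-\langle T_\alpha(s),T_\beta(t)\rangle^2}}.$$ The mean curvature (with respect to $N$) is $$H=\frac{\kappa_\alpha\langle B_\alpha,T_\beta\rangle-\kappa_\beta\langle T_\alpha,B_\beta\rangle-2\langle T_\alpha,T_\beta\rangle\left[\langle T_\alpha,T_\beta\rangle^2-1\right]}{2\left[1-\langle T_\alpha,T_\beta\rangle^2\right]^{3/2}},$$ and the Gaussian curvature is $$K=-\frac{\kappa_\alpha\kappa_\beta\langle B_\alpha,T_\beta\rangle\langle T_\alpha,B_\beta\rangle}{\left(1-\langle T_\alpha,T_\beta\rangle^2\right)^2}.$$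
   Context: $\mathbb{R}^4$ is identified with the quaternions, $(x_1,x_2,x_3,x_4)\leftrightarrow x_1+ix_2+jx_3+kx_4$; ''$\cdot$'' is quaternion multiplication, $\overline{x}$ is quaternionic conjugation, and $\langle\cdot,\cdot\rangle$ is the Euclidean inner product. $\mathbb{S}^3$ is the group of unit quaternions with the induced (bi-invariant) metric. A translation surface in $\mathbb{S}^3$ is a surface locally parametrized as $X(s,t)=\alpha(s)\cdot\beta(t)$ with generating curves $\alpha,\beta$ in $\mathbb{S}^3$. For a curve $\gamma$ in $\mathbb{S}^3$ parametrized by arc length, $t_\gamma=\gamma'$, $\kappa_\gamma=|\nabla_{\gamma'}\gamma'|$ ($\nabla$ the Levi-Civita connection of $\mathbb{S}^3$); where $\kappa_\gamma\ne0$, $n_\gamma=\kappa_\gamma^{-1}\nabla_{\gamma'}\gamma'$, and $b_\gamma\in T_\gamma\mathbb{S}^3$ is the unit vector orthogonal to $t_\gamma,n_\gamma$ with $\det(\gamma,t_\gamma,n_\gamma,b_\gamma)>0$. For the first generating curve $\alpha$ the left frame is used: $T_\alpha=\overline{\alpha}\cdot t_\alpha$, $N_\alpha=\overline{\alpha}\cdot n_\alpha$, $B_\alpha=\overline{\alpha}\cdot b_\alpha$. For the second generating curve $\beta$ the right frame is used: $T_\beta=\beta\cdot\overline{t_\beta}$, $N_\beta=\beta\cdot\overline{n_\beta}$, $B_\beta=\beta\cdot\overline{b_\beta}$. $T_\alpha$, $T_\beta$ are defined for all arc length curves; the products $\kappa_\alpha B_\alpha$ and $\kappa_\beta B_\beta$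 are understood to be $0$ where the corresponding curvature vanishes. The mean curvature is $H=\frac12\frac{eG-2fF+gE}{EG-F^2}$, where $E=\langle X_s,X_s\rangle$, $F=\langle X_s,X_t\rangle$, $G=\langle X_t,X_t\rangle$, $e=\langle X_{ss},N\rangle$, $f=\langle X_{st},N\rangle$, $g=\langle X_{tt},N\rangle$. The Gaussian curvature $K$ is the intrinsic curvature, $K=\frac{eg-f^2}{EG-F^2}+1$. *)

(* Defs.v *)
From HB Require Import structures.
From mathcomp Require Import all_boot all_order all_algebra.
From mathcomp Require Import all_classical all_reals all_analysis.

Set Implicit Arguments.
Unset Strict Implicit.
Unset Printing Implicit Defensive.

Import Order.TTheory GRing.Theory Num.Theory.
Import numFieldNormedType.Exports.

Local Open Scope classical_set_scope.
Local Open Scope ring_scope.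

Section Quaternions.
Context {R : realType}.
Implicit Types x y : 'rV[R]_4.

(* a + i b + j c + k d *)
Definition quat (a b c d : R) : 'rV[R]_4 := \row_(i < 4) [:: a; b; c; d]`_i.

(* Here 0, 1, 2, 3 are elements of 'I_4. *)
Definition qmul x y : 'rV[R]_4 :=
  quat (x 0 0 * y 0 0 - x 0 1 * y 0 1 - x 0 2 * y 0 2 - x 0 3 * y 0 3)
       (x 0 0 * y 0 1 + x 0 1 * y 0 0 + x 0 2 * y 0 3 - x 0 3 * y 0 2)
       (x 0 0 * y 0 2 - x 0 1 * y 0 3 + x 0 2 * y 0 0 + x 0 3 * y 0 1)
       (x 0 0 * y 0 3 + x 0 1 * y 0 2 - x 0 2 * y 0 1 + x 0 3 * y 0 0).

Definition qconj x : 'rV[R]_4 := quat (x 0 0) (- x 0 1) (- x 0 2) (- x 0 3).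

Definition dot x y : R := \sum_(i < 4) x 0 i * y 0 i.

(* The Euclidean norm; the library norm `|x| on 'rV[R]_4 is the sup norm. *)
Definition enorm x : R := Num.sqrt (dot x x).

Definition det4 (x y z w : 'rV[R]_4) : R :=
  \det (\matrix_(i < 4) [:: x; y; z; w]`_i).

Definition S3 : set 'rV[R]_4 := [set x | enorm x = 1].

End Quaternions.

Notation "x *q y" := (qmul x y) (at level 40, left associativity) : ring_scope.

Section Curves.
Context {R : realType}.
Implicit Types (I : set R) (c V : R -> 'rV[R]_4) (s : R).

Definition smooth_on I c := forall n s, I s -> derivable (derive1n n c) s 1.

(* Curves are total functions of which only the restriction to the open
   interval I is meaningful. *)
Definition arclength_curve I c :=
  [/\ smooth_on I c,
      forall s, I s -> S3 (c s) &
      forall s, I s -> enorm (derive1 c s) = 1].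

(* Covariant derivative in S^3 of a vector field V along c: the Levi-Civita
   connection of the induced metric is the tangential part of the derivative
   in R^4. *)
Definition covariant_derivative c V s : 'rV[R]_4 :=
  derive1 V s - dot (derive1 V s) (c s) *: c s.

Definition tangent c s : 'rV[R]_4 := derive1 c s.

Definition curvature c s : R :=
  enorm (covariant_derivative c (tangent c) s).

Definition normal c s : 'rV[R]_4 :=
  (curvature c s)^-1 *: covariant_derivative c (tangent c) s.

Definition is_binormal c s (b : 'rV[R]_4) : Prop :=
  [/\ dot b (c s) = 0, enorm b = 1,
      dot b (tangent c s) = 0, dot b (normal c s) = 0 &
      0 < det4 (c s) (tangent c s) (normal c s) b].

(* Where the curvature vanishes, normal c s is 0, no vector satisfies
   is_binormal and binormal c s is 0. *)
Definition binormal c s : 'rV[R]_4 := xget 0 [set b | is_binormal c s b].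

Definition leftT c s : 'rV[R]_4 := qconj (c s) *q tangent c s.
Definition leftB c s : 'rV[R]_4 := qconj (c s) *q binormal c s.

Definition rightT c s : 'rV[R]_4 := c s *q qconj (tangent c s).
Definition rightB c s : 'rV[R]_4 := c s *q qconj (binormal c s).

End Curves.

Section Surfaces.
Context {R : realType}.
Implicit Types (X : R -> R -> 'rV[R]_4) (s t : R) (nu : 'rV[R]_4).

Definition translation_surface (a b : R -> 'rV[R]_4) : R -> R -> 'rV[R]_4 :=
  fun s t => a s *q b t.

Definition partial_s X : R -> R -> 'rV[R]_4 := fun s t => derive1 (X^~ t) s.
Definition partial_t X : R -> R -> 'rV[R]_4 := fun s t => derive1 (X s) t.

(* X is an immersion at (s, t). *)
Definition regular_at X s t : bool :=
  row_free (col_mx (partial_s X s t) (partial_t X s t)).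

Definition is_unit_normal X s t nu : Prop :=
  [/\ dot nu (X s t) = 0, dot nu (partial_s X s t) = 0,
      dot nu (partial_t X s t) = 0 & enorm nu = 1].

Definition formE X s t : R := dot (partial_s X s t) (partial_s X s t).
Definition formF X s t : R := dot (partial_s X s t) (partial_t X s t).
Definition formG X s t : R := dot (partial_t X s t) (partial_t X s t).

Definition form_e X nu s t : R := dot (partial_s (partial_s X) s t) nu.
Definition form_f X nu s t : R := dot (partial_t (partial_s X) s t) nu.
Definition form_g X nu s t : R := dot (partial_t (partial_t X) s t) nu.

Definition mean_curvature X nu s t : R :=
  2^-1 * ((form_e X nu s t * formG X s t
           - 2 * form_f X nu s t * formF X s t
           + form_g X nu s t * formE X s t)
          / (formE X s t * formG X s t - formF X s t ^+ 2)).

(* Gauss equation in S^3: intrinsic = extrinsic curvature + 1. *)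
Definition gauss_curvature X nu s t : R :=
  (form_e X nu s t * form_g X nu s t - form_f X nu s t ^+ 2)
  / (formE X s t * formG X s t - formF X s t ^+ 2) + 1.

End Surfaces.

(* Main.v *)
Require Import Defs.
From mathcomp Require Import all_boot all_order all_algebra.
From mathcomp Require Import all_classical all_reals all_analysis.
From mathcomp Require Import ring lra.

(* Left and right multiplication by unit quaternions are isometries, so the
   scalar products in the fundamental forms of [X = ab] reduce to products of
   the frames. The second order partial derivatives are a''b, a'b' and ab''.
   Writing g'' = k n - g for an arc length curve g, its binormal satisfies
   k b = t g^-1 (k n); together with x y^-1 = - y x^-1 for orthogonal unit
   quaternions and r = sqrt (1 - c^2), c = <T_a, T_b>, this gives E = G = 1,
   F = - c, e = k_a <B_a, T_b> / r, f = r and g = - k_b <T_a, B_b> / r. *)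

Set Implicit Arguments.
Unset Strict Implicit.
Unset Printing Implicit Defensive.

Import Order.TTheory GRing.Theory Num.Theory.
Import numFieldNormedType.Exports.

Local Open Scope classical_set_scope.
Local Open Scope ring_scope.

(** * Quaternion identities and the triple product y x^-1 z *)

Section QuaternionAlgebra.
Context {R : realType}.
Implicit Types (x y z u v w : 'rV[R]_4) (k : R).

Lemma quatE (a b c d : R) :
  (((quat a b c d) 0 0 = a) * ((quat a b c d) 0 1 = b) *
  ((quat a b c d) 0 2 = c) * ((quat a b c d) 0 3 = d))%type.
Proof. by rewrite /quat !mxE. Qed.

Lemma rV4P x y : x 0 0 = y 0 0 -> x 0 1 = y 0 1 -> x 0 2 = y 0 2 ->
  x 0 3 = y 0 3 -> x = y.
Proof.
move=> e0 e1 e2 e3; apply/rowP => -[[|[|[|[|//]]]] i4].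
- by rewrite (_ : Ordinal i4 = 0) //; apply: val_inj.
- by rewrite (_ : Ordinal i4 = 1) //; apply: val_inj.
- by rewrite (_ : Ordinal i4 = 2) //; apply: val_inj.
- by rewrite (_ : Ordinal i4 = 3) //; apply: val_inj.
Qed.

Lemma dotE x y : dot x y =
  x 0 0 * y 0 0 + x 0 1 * y 0 1 + x 0 2 * y 0 2 + x 0 3 * y 0 3.
Proof.
rewrite /dot !big_ord_recl big_ord0 addr0 !addrA.
by congr (_ + _ + _ + _); congr (x 0 _ * y 0 _); apply: val_inj.
Qed.

Lemma qmulE x y :
 (((x *q y) 0 0 = (x 0 0 * y 0 0 - x 0 1 * y 0 1 - x 0 2 * y 0 2 - x 0 3 * y 0 3)%R) *
  ((x *q y) 0 1 = (x 0 0 * y 0 1 + x 0 1 * y 0 0 + x 0 2 * y 0 3 - x 0 3 * y 0 2)%R) *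
  ((x *q y) 0 2 = (x 0 0 * y 0 2 - x 0 1 * y 0 3 + x 0 2 * y 0 0 + x 0 3 * y 0 1)%R) *
  ((x *q y) 0 3 = (x 0 0 * y 0 3 + x 0 1 * y 0 2 - x 0 2 * y 0 1 + x 0 3 * y 0 0)%R))%type.
Proof. by rewrite /qmul !quatE. Qed.

Lemma qconjE x : (((qconj x) 0 0 = x 0 0) * ((qconj x) 0 1 = (- x 0 1)%R) *
  ((qconj x) 0 2 = (- x 0 2)%R) * ((qconj x) 0 3 = (- x 0 3)%R))%type.
Proof. by rewrite /qconj !quatE. Qed.

Lemma qmulA x y z : x *q (y *q z) = x *q y *q z.
Proof. by apply: rV4P; rewrite !qmulE; ring. Qed.

Lemma qconjM x y : qconj (x *q y) = qconj y *q qconj x.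
Proof. by apply: rV4P; rewrite !(qconjE, qmulE); ring. Qed.

Lemma dotC x y : dot x y = dot y x.
Proof. by rewrite !dotE; ring. Qed.

Lemma dotDl x y z : dot (x + y) z = dot x z + dot y z.
Proof. by rewrite !dotE !mxE; ring. Qed.

Lemma dotZl k x y : dot (k *: x) y = k * dot x y.
Proof. by rewrite !dotE !mxE; ring. Qed.

Lemma dotNl x y : dot (- x) y = - dot x y.
Proof. by rewrite -scaleN1r dotZl mulN1r. Qed.

Lemma dotDr x y z : dot z (x + y) = dot z x + dot z y.
Proof. by rewrite dotC dotDl !(dotC z). Qed.

Lemma dotZr k x y : dot y (k *: x) = k * dot y x.
Proof. by rewrite dotC dotZl dotC. Qed.

Lemma dotNr x y : dot y (- x) = - dot y x.
Proof. by rewrite dotC dotNl dotC. Qed.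

Lemma dot_qmul2l x y z : dot (x *q y) (x *q z) = dot x x * dot y z.
Proof. by rewrite !dotE !qmulE; ring. Qed.

Lemma dot_qmul2r x y z : dot (y *q x) (z *q x) = dot x x * dot y z.
Proof. by rewrite !dotE !qmulE; ring. Qed.

Lemma dot_qconj x y : dot (qconj x) (qconj y) = dot x y.
Proof. by rewrite !dotE !qconjE; ring. Qed.

Lemma dot_qmull x y z : dot (x *q y) z = dot y (qconj x *q z).
Proof. by rewrite !dotE !(qmulE, qconjE); ring. Qed.

Lemma dot_qmulr x y z : dot (y *q x) z = dot y (z *q qconj x).
Proof. by rewrite !dotE !(qmulE, qconjE); ring. Qed.

Lemma qmulDl x y z : (x + y) *q z = x *q z + y *q z.
Proof. by apply: rV4P; rewrite !(qmulE, mxE); ring. Qed.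

Lemma qmulDr x y z : z *q (x + y) = z *q x + z *q y.
Proof. by apply: rV4P; rewrite !(qmulE, mxE); ring. Qed.

Lemma qmulZl k x y : (k *: x) *q y = k *: (x *q y).
Proof. by apply: rV4P; rewrite !(qmulE, mxE); ring. Qed.

Lemma qmulZr k x y : x *q (k *: y) = k *: (x *q y).
Proof. by apply: rV4P; rewrite !(qmulE, mxE); ring. Qed.

Lemma qmul0r x : 0 *q x = 0.
Proof. by rewrite -(scale0r x) qmulZl !scale0r. Qed.

Lemma qmulr0 x : x *q 0 = 0.
Proof. by rewrite -(scale0r x) qmulZr !scale0r. Qed.

Lemma qmulNl x y : (- x) *q y = - (x *q y).
Proof. by rewrite -scaleN1r qmulZl scaleN1r. Qed.

Lemma qmulNr x y : x *q (- y) = - (x *q y).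
Proof. by rewrite -scaleN1r qmulZr scaleN1r. Qed.

Lemma qconjZ k x : qconj (k *: x) = k *: qconj x.
Proof. by apply: rV4P; rewrite !(qconjE, mxE); ring. Qed.

Lemma qconjK x : qconj (qconj x) = x.
Proof. by apply: rV4P; rewrite !qconjE; ring. Qed.

Lemma qmulKl x y : x *q (qconj x *q y) = dot x x *: y.
Proof. by apply: rV4P; rewrite !dotE !(qmulE, qconjE, mxE); ring. Qed.

Lemma qmulKl_conj x y : qconj x *q (x *q y) = dot x x *: y.
Proof. by have := qmulKl (qconj x) y; rewrite qconjK dot_qconj. Qed.

(** Polarizing conj(x) x = |x|^2 gives conj(x) y + conj(y) x = 2 <x, y>, a real quaternion. *)
Lemma qmul_conj_anticomm x y : dot x y = 0 -> qconj x *q y = - (qconj y *q x).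
Proof.
move=> xy; apply/eqP; rewrite -addr_eq0; apply/eqP.
rewrite -[RHS](scale0r (quat 2 0 0 0)) -[X in _ = X *: _]xy.
by apply: rV4P; rewrite dotE !(quatE, qmulE, qconjE, mxE); ring.
Qed.

Lemma qmul_anticomm_conj x y : dot x y = 0 -> x *q qconj y = - (y *q qconj x).
Proof. by rewrite -dot_qconj => /qmul_conj_anticomm; rewrite !qconjK. Qed.

(** For orthonormal arguments y x^-1 z is the ternary cross product. Each of the three inner
    products is a polynomial combination of the pairwise ones assumed to vanish. *)
Lemma dot_triple x y z : dot x y = 0 -> dot x z = 0 -> dot y z = 0 ->
  [/\ dot (y *q qconj x *q z) x = 0, dot (y *q qconj x *q z) y = 0 &
      dot (y *q qconj x *q z) z = 0].
Proof.
move=> xy xz yz; split.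
- transitivity (2 * dot x y * dot x z - dot y z * dot x x); last first.
    by rewrite xy yz; ring.
  by rewrite !dotE !(qmulE, qconjE); ring.
- transitivity (dot y y * dot x z); last by rewrite xz mulr0.
  by rewrite !dotE !(qmulE, qconjE); ring.
- transitivity (dot z z * dot x y); last by rewrite xy mulr0.
  by rewrite !dotE !(qmulE, qconjE); ring.
Qed.

Lemma qmulr1 x : x *q quat 1 0 0 0 = x.
Proof. by apply: rV4P; rewrite !(quatE, qmulE); ring. Qed.

(** No dimension count is made: orthogonality of [w] to [x], [y] and [z] enters only as
    anticommutation with each of them. *)
Lemma orth4_expansion x y z w :
  dot x x = 1 -> dot y y = 1 -> dot z z = 1 ->
  dot x y = 0 -> dot x z = 0 -> dot y z = 0 ->
  dot w x = 0 -> dot w y = 0 -> dot w z = 0 ->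
  w = dot w (y *q qconj x *q z) *: (y *q qconj x *q z).
Proof.
move=> xx yy zz xy xz yz wx wy wz.
set p := y *q qconj x *q z.
have pp : dot p p = 1.
  by rewrite /p dot_qmul2r dot_qmul2r dot_qconj xx yy zz !mul1r.
have NN (u : 'rV[R]_4) : - - u = u by exact: opprK.
(* Anticommuting the factors shows that [p^-1 w] is its own conjugate, hence a
   real number. *)
have qr : qconj p *q w = qconj (qconj p *q w).
  rewrite qconjM qconjK /p !qconjM qconjK -!qmulA.
  rewrite (@qmul_conj_anticomm y w) 1?dotC//.
  rewrite qmulNr qmulNr (qmulA x) (@qmul_anticomm_conj x w) 1?dotC//.
  rewrite qmulNl qmulNr NN -(qmulA w) (qmulA (qconj z)).
  rewrite (@qmul_conj_anticomm z w) 1?dotC// qmulNl -!qmulA -qmulNr.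
  congr (_ *q _).
  (* Three exchanges have moved [w] to the front with total sign -1. Three more, again of total sign
     -1, reverse the order of the remaining factors. *)
  rewrite qmulA (@qmul_anticomm_conj z x) 1?dotC// qmulNl NN -qmulA.
  rewrite (@qmul_conj_anticomm z y) 1?dotC// qmulNr qmulA.
  by rewrite (@qmul_anticomm_conj x y)// qmulNl NN qmulA.
have re : qconj p *q w = dot w p *: quat 1 0 0 0.
  have hh u : u = qconj u -> u = u 0 0 *: quat 1 0 0 0.
    move=> /rowP uu; apply: rV4P; rewrite !(quatE, mxE).
    - by ring.
    - by have := uu 1; rewrite qconjE; lra.
    - by have := uu 2; rewrite qconjE; lra.
    - by have := uu 3; rewrite qconjE; lra.
  rewrite (hh _ qr); congr (_ *: _).
  by rewrite qmulE !qconjE dotE; ring.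
by rewrite -[LHS]scale1r -pp -qmulKl re qmulZr qmulr1.
Qed.

Lemma det_mx33 (A : 'M[R]_3) : \det A =
  A 0 0 * (A 1 1 * A 2 2 - A 1 2 * A 2 1)
  - A 0 1 * (A 1 0 * A 2 2 - A 1 2 * A 2 0)
  + A 0 2 * (A 1 0 * A 2 1 - A 1 1 * A 2 0).
Proof.
rewrite (expand_det_row _ 0) !big_ord_recl big_ord0 /cofactor.
rewrite !(expand_det_row _ 0) !big_ord_recl !big_ord0 /cofactor !det_mx11 !mxE /=.
(* The expansion writes one ordinal in several ways, as different lifts. Reindexing the entries by
   natural numbers lets [ring] identify them. *)
pose f i j := A (inord i) (inord j).
have fE i j : A i j = f i j by rewrite /f !inord_val.
by rewrite !fE /= /bump /=; ring.
Qed.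

(** For pairwise orthogonal [x], [y], [z] the corrections vanish and the triple product represents
    the linear form [det4 x y z]. This decides the sign of the binormal. *)
Lemma det4E x y z w : det4 x y z w = dot (y *q qconj x *q z) w
  - dot x y * dot z w - dot x z * dot y w + dot y z * dot x w.
Proof.
rewrite /det4 (expand_det_row _ 0) !big_ord_recl big_ord0 /cofactor.
rewrite !det_mx33 !mxE /= !dotE !(qmulE, qconjE).
pose f u i := u 0 (inord i) : R.
have fE u (i : 'I_4) : u 0 i = f u i by rewrite /f !inord_val.
by rewrite !fE /= /bump /=; ring.
Qed.

End QuaternionAlgebra.

(** * Euclidean norm *)

Section Norm.
Context {R : realType}.
Implicit Types (x y z u v w : 'rV[R]_4).

Lemma dot_ge0 x : 0 <= dot x x.
Proof. by rewrite /dot sumr_ge0 // => i _; rewrite -expr2 sqr_ge0. Qed.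

Lemma dot_eq0 x : dot x x = 0 -> x = 0.
Proof.
move=> xx; apply/rowP => i; rewrite mxE.
have := @psumr_eq0P _ _ xpredT (fun i => x 0 i * x 0 i).
by move=> /(_ (fun i _ => sqr_ge0 _) xx i isT)/eqP; rewrite mulf_eq0 orbb => /eqP.
Qed.

Lemma sqr_enorm x : enorm x ^+ 2 = dot x x.
Proof. by rewrite sqr_sqrtr // dot_ge0. Qed.

Lemma enorm_eq0 x : enorm x = 0 -> x = 0.
Proof. by move=> x0; apply: dot_eq0; rewrite -sqr_enorm x0 expr0n. Qed.

Lemma enorm1P x : enorm x = 1 <-> dot x x = 1.
Proof.
split=> [x1|x1]; first by rewrite -sqr_enorm x1 expr1n.
by rewrite /enorm x1 sqrtr1.
Qed.

End Norm.

(** * Product rules for curves of quaternions *)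

Section Derivatives.
Context {R : realType}.
Implicit Types (f g : R -> 'rV[R]_4) (s : R).

Lemma is_derive_rVP f s (df : 'rV[R]_4) :
  is_derive s 1 f df <-> forall i, is_derive s 1 (fun x => f x 0 i) (df 0 i).
Proof.
split=> [[fs <-] i|fs].
  split; first exact: (derivable_mxP _ _ _).1.
  by rewrite derive_mx // mxE.
have fd : derivable f s 1.
  by apply/derivable_mxP => i j; rewrite ord1; exact: (@ex_derive _ _ _ _ _ _ _ (fs j)).
split=> //; rewrite derive_mx //; apply/rowP => i.
by rewrite mxE; apply: (@derive_val _ _ _ _ _ _ _ (fs i)).
Qed.

Lemma is_derive1 f s : derivable f s 1 -> is_derive s 1 f (derive1 f s).
Proof. by move=> fs; rewrite derive1E; exact/derivableP. Qed.

Lemma is_derive1_val (V : normedModType R) (f : R -> V) s df :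
  is_derive s 1 f df -> derive1 f s = df.
Proof. by move=> fs; rewrite derive1E derive_val. Qed.

Lemma is_derive_dot f g s df dg : is_derive s 1 f df -> is_derive s 1 g dg ->
  is_derive s 1 (fun x => dot (f x) (g x)) (dot df (g s) + dot (f s) dg).
Proof.
move=> /is_derive_rVP fs /is_derive_rVP gs.
rewrite (_ : (fun x => _) = \sum_(i < 4) ((fun x => f x 0 i) * (fun x => g x 0 i))).
  apply: is_derive_eq; rewrite /dot -big_split /=; apply: eq_bigr => i _.
  by rewrite /GRing.scale /=; ring.
by apply/funext => x; rewrite fct_sumE; exact: eq_bigr.
Qed.

Lemma is_derive_qmul f g s df dg : is_derive s 1 f df -> is_derive s 1 g dg ->
  is_derive s 1 (fun x => f x *q g x) (df *q g s + f s *q dg).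
Proof.
move=> /is_derive_rVP fs /is_derive_rVP gs; apply/is_derive_rVP.
(* With the coordinate functions named, every component of the product is a signed sum of scalar
   products [F i * G j], whose derivatives are collected in [M]. *)
pose F i (x : R) := f x 0 i; pose G i (x : R) := g x 0 i.
have dF i : is_derive s 1 (F i) (df 0 i) by exact: fs.
have dG i : is_derive s 1 (G i) (dg 0 i) by exact: gs.
have M i j : is_derive s 1 (F i * G j) (F i s *: dg 0 j + G j s *: df 0 i).
  exact: is_deriveM.
move=> -[[|[|[|[|//]]]] i4].
- rewrite (_ : (fun x => _) = F 0 * G 0 - F 1 * G 1 - F 2 * G 2 - F 3 * G 3); last first.
    by apply/funext => x; rewrite mxE.
  apply: is_derive_eq (is_deriveB (is_deriveB (is_deriveB (M 0 0) (M 1 1)) (M 2 2)) (M 3 3)) _.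
  by rewrite !mxE /= /F /G /GRing.scale /=; ring.
- rewrite (_ : (fun x => _) = F 0 * G 1 + F 1 * G 0 + F 2 * G 3 - F 3 * G 2); last first.
    by apply/funext => x; rewrite mxE.
  apply: is_derive_eq (is_deriveB (is_deriveD (is_deriveD (M 0 1) (M 1 0)) (M 2 3)) (M 3 2)) _.
  by rewrite !mxE /= /F /G /GRing.scale /=; ring.
- rewrite (_ : (fun x => _) = F 0 * G 2 - F 1 * G 3 + F 2 * G 0 + F 3 * G 1); last first.
    by apply/funext => x; rewrite mxE.
  apply: is_derive_eq (is_deriveD (is_deriveD (is_deriveB (M 0 2) (M 1 3)) (M 2 0)) (M 3 1)) _.
  by rewrite !mxE /= /F /G /GRing.scale /=; ring.
- rewrite (_ : (fun x => _) = F 0 * G 3 + F 1 * G 2 - F 2 * G 1 + F 3 * G 0); last first.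
    by apply/funext => x; rewrite mxE.
  apply: is_derive_eq (is_deriveD (is_deriveB (is_deriveD (M 0 3) (M 1 2)) (M 2 1)) (M 3 0)) _.
  by rewrite !mxE /= /F /G /GRing.scale /=; ring.
Qed.

Lemma derive1_qmulr f s v : derivable f s 1 ->
  derive1 (fun x => f x *q v) s = derive1 f s *q v.
Proof.
move=> fs; apply: is_derive1_val.
apply: is_derive_eq (is_derive_qmul (is_derive1 fs) (is_derive_cst v s 1)) _.
by rewrite qmulr0 addr0.
Qed.

Lemma derive1_qmull f s v : derivable f s 1 ->
  derive1 (fun x => v *q f x) s = v *q derive1 f s.
Proof.
move=> fs; apply: is_derive1_val.
apply: is_derive_eq (is_derive_qmul (is_derive_cst v s 1) (is_derive1 fs)) _.
by rewrite qmul0r add0r.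
Qed.

(** Curves are constrained only on their open intervals, so a derivative can be differentiated again
    only through an identity valid near the point. *)
Lemma near_derive1 (V : normedModType R) (f g : R -> V) s :
  (\near s, f s = g s) -> derive1 f s = derive1 g s.
Proof. by move=> fg; rewrite !derive1E; exact: near_eq_derive. Qed.

End Derivatives.

(** * Arc length curves in the sphere and their binormals *)

Section ArclengthCurves.
Context {R : realType}.
Implicit Types (f g c : R -> 'rV[R]_4) (s : R).

Lemma dot_derive_cst (I : set R) f g (k s : R) : open I -> I s ->
  (forall x, I x -> dot (f x) (g x) = k) ->
  derivable f s 1 -> derivable g s 1 ->
  dot (derive1 f s) (g s) + dot (f s) (derive1 g s) = 0.
Proof.
move=> oI Is fgk fs gs.
rewrite -(is_derive1_val (is_derive_dot (is_derive1 fs) (is_derive1 gs))).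
rewrite (@near_derive1 _ _ _ (cst k)); first by rewrite derive1_cst.
near=> x; apply: fgk; near: x; exact: open_nbhs_nbhs.
Unshelve. all: by end_near. Qed.

Context {I : set R} {c : R -> 'rV[R]_4}.
Context (openI : open I) (hc : arclength_curve I c).

Lemma arclength_derivable s : I s -> derivable c s 1.
Proof. by case: hc => + _ _ => /(_ 0) /[apply]. Qed.

Lemma arclength_derivable1 s : I s -> derivable (derive1 c) s 1.
Proof. by case: hc => + _ _ => /(_ 1) /[apply]. Qed.

Lemma arclength_sphere s : I s -> dot (c s) (c s) = 1.
Proof. by case: hc => _ + _ => /[apply] /enorm1P. Qed.

Lemma arclength_speed s : I s -> dot (derive1 c s) (derive1 c s) = 1.
Proof. by case: hc => _ _ /[apply] /enorm1P. Qed.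

Lemma arclength_orth s : I s -> dot (c s) (derive1 c s) = 0.
Proof.
move=> Is; have cs := arclength_derivable Is.
have := dot_derive_cst openI Is arclength_sphere cs cs.
by rewrite (dotC (derive1 c s)); lra.
Qed.

Lemma arclength_acc_tangent s : I s ->
  dot (derive1 (derive1 c) s) (derive1 c s) = 0.
Proof.
move=> Is; have cs := arclength_derivable1 Is.
have := dot_derive_cst openI Is arclength_speed cs cs.
by rewrite (dotC (derive1 c s)); lra.
Qed.

(** Differentiating <c, c'> = 0 gives <c'', c> = - <c', c'>. Hence the tangential part of c'' is c''
    + c. *)
Lemma arclength_acc_position s : I s ->
  dot (derive1 (derive1 c) s) (c s) = - 1.
Proof.
move=> Is.
have := dot_derive_cst openI Is arclength_orth (arclength_derivable Is)
  (arclength_derivable1 Is).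
by rewrite arclength_speed // (dotC (c s)); lra.
Qed.

Lemma covariant_tangentE s : I s ->
  covariant_derivative c (tangent c) s = derive1 (derive1 c) s + c s.
Proof.
by move=> Is; rewrite /covariant_derivative /tangent arclength_acc_position // scaleN1r opprK.
Qed.

(** At zero curvature both sides vanish, because the covariant derivative then has norm 0. *)
Lemma curvature_normal s :
  curvature c s *: normal c s = covariant_derivative c (tangent c) s.
Proof.
have [k0|k0] := eqVneq (curvature c s) 0; last by rewrite /normal scalerA divff // scale1r.
by rewrite k0 scale0r (enorm_eq0 k0).
Qed.

(** The triple product of the orthonormal vectors c, t, n is a unit vector orthogonal to them, with
    determinant <p, p> = 1. Any other candidate is its opposite, which has the wrong orientation. *)
Lemma binormalE s : I s -> curvature c s != 0 ->
  binormal c s = derive1 c s *q qconj (c s) *q normal c s.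
Proof.
move=> Is k0.
set n := normal c s.
have cc := arclength_sphere Is; have tt := arclength_speed Is.
have ct := arclength_orth Is.
have kn : curvature c s *: n = derive1 (derive1 c) s + c s.
  by rewrite curvature_normal covariant_tangentE.
have nn : dot n n = 1.
  rewrite /n /normal dotZl dotZr -sqr_enorm -/(curvature c s).
  by field.
have cn : dot (c s) n = 0.
  apply: (mulfI k0); rewrite mulr0 -dotZr kn dotDr dotC.
  by rewrite arclength_acc_position // cc; lra.
have tn : dot (derive1 c s) n = 0.
  apply: (mulfI k0); rewrite mulr0 -dotZr kn dotDr dotC.
  by rewrite arclength_acc_tangent // dotC ct; lra.
set p := _ *q n.
have pp : dot p p = 1 by rewrite /p !dot_qmul2r dot_qconj cc tt nn !mulr1.
have dot_p w : det4 (c s) (derive1 c s) n w = dot p w.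
  by rewrite det4E ct cn tn; ring.
have [pc pt pn] := dot_triple ct cn tn; rewrite -/p in pc pt pn.
have bp : is_binormal c s p.
  by split=> //; [exact/enorm1P | rewrite -/n dot_p pp].
(* The witness [p] rules out the default value of [xget]; it remains to compare the chosen [b] with
   [p]. *)
rewrite /binormal; case: xgetP => [b _|/(_ p)//] [bc b1 bt bn].
rewrite -/n dot_p => b0.
have bE := orth4_expansion cc tt nn ct cn tn bc bt bn; rewrite -/p in bE.
have : dot b p ^+ 2 = 1.
  by move/enorm1P : b1; rewrite {1 2}bE dotZl dotZr pp mulr1.
move/eqP; rewrite sqrf_eq1 => /orP[]/eqP d1; first by rewrite bE d1 scale1r.
by move: b0; rewrite dotC d1 ltr0N1.
Qed.

(** Multiplying by the curvature removes the division in [normal], so points of zero curvature need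
    no separate treatment later. *)
Lemma curvature_binormal s : I s ->
  curvature c s *: binormal c s =
  derive1 c s *q qconj (c s) *q (derive1 (derive1 c) s + c s).
Proof.
move=> Is; rewrite -covariant_tangentE // -curvature_normal qmulZr.
have [->|k0] := eqVneq (curvature c s) 0; first by rewrite !scale0r.
by rewrite binormalE.
Qed.

End ArclengthCurves.

(** * Inner products of left frames with right frames *)

Lemma dot_frames {R : realType} (x y u v : 'rV[R]_4) :
  dot (qconj x *q y) (u *q qconj v) = dot (y *q v) (x *q u).
Proof. by rewrite dot_qmull qconjK qmulA -dot_qmulr. Qed.

Section CurvatureBinormal.
Context {R : realType} {I : set R} {c : R -> 'rV[R]_4} {s : R}.
Context (openI : open I) (hc : arclength_curve I c) (Is : I s).

(** Two exchanges, t c^-1 = - c t^-1 and u v^-1 = - v u^-1, each cost a sign and the signs cancel.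
    It is applied to u = b, v = b' of the second curve. *)
Lemma curvature_leftB (u v : 'rV[R]_4) : dot u v = 0 ->
  curvature c s * dot (leftB c s) (u *q qconj v) =
  dot ((derive1 (derive1 c) s + c s) *q u) (derive1 c s *q v).
Proof.
move=> uv; rewrite -dotZl /leftB -qmulZr (curvature_binormal openI hc Is).
set n := derive1 (derive1 c) s + c s.
rewrite dot_frames (@qmul_anticomm_conj _ (derive1 c s) (c s)); last first.
  by rewrite dotC (arclength_orth openI hc Is).
rewrite !qmulNl dotNl -!qmulA dot_qmul2l (arclength_sphere hc Is) mul1r.
rewrite dot_qmull qconjK -dot_frames (qmul_anticomm_conj uv).
by rewrite dotNr opprK dot_frames.
Qed.

(** Here the single exchange c n^-1 = - n c^-1 is made. Its sign is the one in front of the [rightB]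
    term of the mean curvature. *)
Lemma curvature_rightB (x y : 'rV[R]_4) :
  curvature c s * dot (qconj x *q y) (rightB c s) =
  - dot (x *q (derive1 (derive1 c) s + c s)) (y *q derive1 c s).
Proof.
rewrite -dotZr /rightB -qmulZr -qconjZ (curvature_binormal openI hc Is).
set n := derive1 (derive1 c) s + c s.
have cn : dot (c s) n = 0.
  rewrite dotDr (arclength_sphere hc Is) dotC.
  by rewrite (arclength_acc_position openI hc Is) addNr.
rewrite dot_frames !qmulA dot_qmulr -!qmulA (qmul_anticomm_conj cn).
rewrite !qmulNr dotNr !qmulA dot_qmul2r dot_qconj (arclength_sphere hc Is).
by rewrite mul1r dotC.
Qed.

End CurvatureBinormal.

(** * Linear independence and unit normals from inner products *)

Lemma row_free2P {R : realType} (u v : 'rV[R]_4) : dot u u = 1 -> dot v v = 1 ->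
  row_free (col_mx u v) <-> dot u v ^+ 2 != 1.
Proof.
move=> uu vv; split.
  move=> /row_freeP[B]; apply: contraPneq => k1.
  (* Equality in Cauchy-Schwarz: the residue v - <u, v> u has squared norm 1 - <u, v>^2 = 0. *)
  have e : v = dot u v *: u.
    apply/eqP; rewrite -subr_eq0; apply/eqP; apply: dot_eq0.
    rewrite !(dotDl, dotDr, dotNl, dotNr, dotZl, dotZr) uu vv (dotC v) -expr2.
    by rewrite k1; lra.
  (* The row (- <u, v>, 1) annihilates the matrix, so a right inverse would force this row to be
     0. *)
  move=> f; have := congr1 (mulmx (row_mx (- dot u v)%:M 1%:M)) f.
  rewrite mulmxA mul_row_col !mul_scalar_mx scale1r scaleNr -e addNr mul0mx mulmx1.
  by move/esym/eqP; rewrite row_mx_eq0 oner_eq0 andbF.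
move=> k1; rewrite -kermx_eq0; apply/rowV0P => w /sub_kermxP.
rewrite -[w]hsubmxK mul_row_col.
rewrite [lsubmx w]mx11_scalar [rsubmx w]mx11_scalar !mul_scalar_mx.
set a := lsubmx w 0 0; set b := rsubmx w 0 0 => ab.
(* Pairing a u + b v = 0 with [u] and [v] gives the Gram system, of determinant 1 - <u, v>^2. *)
have e1 : a + b * dot u v = 0.
  have := congr1 (dot u) ab; rewrite dotDr !dotZr uu mulr1 => ->.
  by rewrite -(scale0r u) dotZr mul0r.
have e2 : a * dot u v + b = 0.
  have := congr1 (dot v) ab; rewrite dotDr !dotZr vv mulr1 (dotC v) => ->.
  by rewrite -(scale0r u) dotZr mul0r.
have b0 : b = 0.
  have : b * (dot u v ^+ 2 - 1) = 0.
    transitivity ((a + b * dot u v) * dot u v - (a * dot u v + b)); first by ring.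
    by rewrite e1 e2 mul0r subr0.
  by move/eqP; rewrite mulf_eq0 subr_eq0 (negPf k1) orbF => /eqP.
have a0 : a = 0 by move: e1; rewrite b0 mul0r addr0.
by rewrite a0 b0 !raddf0 row_mx0.
Qed.

Lemma dot_sqr_le1 {R : realType} (u v : 'rV[R]_4) :
  dot u u = 1 -> dot v v = 1 -> dot u v ^+ 2 <= 1.
Proof.
move=> uu vv; rewrite -subr_ge0.
have := dot_ge0 (v + - dot u v *: u).
by rewrite !dotDr !dotDl !dotZl !dotZr uu vv (dotC v); lra.
Qed.

(* Gram-Schmidt turns [z] into [z + k y], up to the factor [r^-1]; the fourth
   vector of the resulting orthonormal frame is [y x^-1 (z + k y) / r]. *)
Lemma unit_normalP {R : realType} (x y z nu : 'rV[R]_4) (k : R) :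
  let n := (Num.sqrt (1 - k ^+ 2))^-1 *: (y *q qconj x *q z - k *: x) in
  dot x x = 1 -> dot y y = 1 -> dot z z = 1 ->
  dot x y = 0 -> dot x z = 0 -> dot y z = - k -> k ^+ 2 != 1 ->
  [/\ dot nu x = 0, dot nu y = 0, dot nu z = 0 & enorm nu = 1] <->
  nu = n \/ nu = - n.
Proof.
move=> n xx yy zz xy xz yz k1.
have r2 : Num.sqrt (1 - k ^+ 2) ^+ 2 = 1 - k ^+ 2.
  by rewrite sqr_sqrtr // subr_ge0 -sqrrN -yz dot_sqr_le1.
move: @n r2; set r := Num.sqrt _ => n r2.
have r0 : r != 0 by rewrite -sqrf_eq0 r2 subr_eq0 eq_sym.
pose w := r^-1 *: (z + k *: y).
have ww : dot w w = 1.
  rewrite dotZl dotZr dotDl !dotDr !dotZl !dotZr yy zz (dotC z) yz.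
  by rewrite (_ : _ + _ = r ^+ 2); [field | rewrite r2; ring].
have xw : dot x w = 0 by rewrite dotZr dotDr dotZr xy xz; ring.
have yw : dot y w = 0 by rewrite dotZr dotDr dotZr yy yz; ring.
have nE : n = y *q qconj x *q w.
  rewrite /n qmulZr qmulDr qmulZr; congr (_ *: (_ + _)).
  rewrite (@qmul_anticomm_conj _ y x) 1?dotC // qmulNl -qmulA scalerN.
  by rewrite -[X in qconj y *q X]qmulr1 qmulKl_conj yy scale1r qmulr1.
have [nx ny nw] := dot_triple xy xw yw; rewrite -nE in nx ny nw.
have zE : z = r *: w - k *: y by rewrite scalerA divff // scale1r addrK.
have nn : dot n n = 1.
  by rewrite nE !dot_qmul2r dot_qconj xx yy ww !mulr1.
split=> [[nux nuy nuz /enorm1P nunu]|nuE].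
  have nuw : dot nu w = 0 by rewrite dotZr dotDr dotZr nuy nuz; ring.
  have nuE := orth4_expansion xx yy ww xy xw yw nux nuy nuw.
  rewrite -nE in nuE.
  have : dot nu n ^+ 2 = 1 by rewrite -nunu [X in dot X X]nuE dotZl dotZr nn mulr1.
  move/eqP; rewrite sqrf_eq1 => /orP[]/eqP d1; rewrite d1 in nuE.
    by left; rewrite nuE scale1r.
  by right; rewrite nuE scaleN1r.
have nz : dot n z = 0.
  by rewrite zE dotDr dotNr (dotZr r) nw (dotZr k) ny; ring.
by case: nuE => ->; split; rewrite ?dotNl ?nx ?ny ?nz ?oppr0 //;
  apply/enorm1P; rewrite ?dotNl ?dotNr ?opprK.
Qed.

(** * Fundamental forms and curvatures of the translation surface *)

Theorem theorem2p1 (R : realType) (I J : set R) (alpha beta : R -> 'rV[R]_4)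
  (openI : open I) (itvI : is_interval I)
  (openJ : open J) (itvJ : is_interval J)
  (halpha : arclength_curve I alpha) (hbeta : arclength_curve J beta) :
  let X := translation_surface alpha beta in
  let c (s t : R) : R := dot (leftT alpha s) (rightT beta t) in
  let N (s t : R) : 'rV[R]_4 :=
    (Num.sqrt (1 - c s t ^+ 2))^-1 *:
      (derive1 alpha s *q derive1 beta t - c s t *: (alpha s *q beta t)) in
  (forall s t : R, I s -> J t ->
     regular_at X s t <-> c s t <> 1 /\ c s t <> -1) /\
  (forall s t : R, I s -> J t -> regular_at X s t ->
     [/\ forall nu : 'rV[R]_4,
           is_unit_normal X s t nu <-> nu = N s t \/ nu = - N s t,
         mean_curvature X (N s t) s t =
           (curvature alpha s * dot (leftB alpha s) (rightT beta t)
            - curvature beta t * dot (leftT alpha s) (rightB beta t)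
            - 2 * c s t * (c s t ^+ 2 - 1))
           / (2 * (1 - c s t ^+ 2) `^ (3 / 2)) &
         gauss_curvature X (N s t) s t =
           - ((curvature alpha s * curvature beta t
               * dot (leftB alpha s) (rightT beta t)
               * dot (leftT alpha s) (rightB beta t))
              / (1 - c s t ^+ 2) ^+ 2)]).
Proof.
move=> X c N.
have XsE s t : I s -> partial_s X s t = derive1 alpha s *q beta t.
  by move=> Is; rewrite /partial_s derive1_qmulr //; exact: (arclength_derivable halpha).
have XtE s t : J t -> partial_t X s t = alpha s *q derive1 beta t.
  by move=> Jt; rewrite /partial_t derive1_qmull //; exact: (arclength_derivable hbeta).
have XssE s t : I s ->
    partial_s (partial_s X) s t = derive1 (derive1 alpha) s *q beta t.
  move=> Is; rewrite -derive1_qmulr; last exact: (arclength_derivable1 halpha).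
  apply: near_derive1; near=> x; apply: XsE; near: x; exact: open_nbhs_nbhs.
have XstE s t : I s -> J t ->
    partial_t (partial_s X) s t = derive1 alpha s *q derive1 beta t.
  move=> Is Jt; rewrite -derive1_qmull; last exact: (arclength_derivable hbeta).
  by apply: near_derive1; near=> x; exact: XsE.
have XttE s t : J t ->
    partial_t (partial_t X) s t = alpha s *q derive1 (derive1 beta) t.
  move=> Jt; rewrite -derive1_qmull; last exact: (arclength_derivable1 hbeta).
  apply: near_derive1; near=> x; apply: XtE; near: x; exact: open_nbhs_nbhs.
have EE s t : I s -> J t -> formE X s t = 1.
  move=> Is Jt; rewrite /formE XsE // dot_qmul2r.
  by rewrite (arclength_sphere hbeta Jt) (arclength_speed halpha Is) mulr1.
have GE s t : I s -> J t -> formG X s t = 1.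
  move=> Is Jt; rewrite /formG XtE // dot_qmul2l.
  by rewrite (arclength_sphere halpha Is) (arclength_speed hbeta Jt) mulr1.
have cE s t : c s t =
    dot (derive1 alpha s *q derive1 beta t) (alpha s *q beta t).
  exact: dot_frames.
have FE s t : I s -> J t -> formF X s t = - c s t.
  move=> Is Jt; rewrite /formF XsE // XtE // -dot_frames.
  rewrite qmul_anticomm_conj ?dotNr //.
  by rewrite dotC (arclength_orth openJ hbeta Jt).
have regE s t : I s -> J t -> regular_at X s t <-> c s t ^+ 2 != 1.
  (* Both partial derivatives are unit vectors with inner product F = - c, so the criterion for two
     unit vectors applies. *)
  move=> Is Jt; rewrite -sqrrN -FE //; exact: row_free2P (EE s t Is Jt) (GE s t Is Jt).
split.
  move=> s t Is Jt; rewrite regE // sqrf_eq1 negb_or.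
  by split=> [/andP[/eqP ? /eqP ?]|[/eqP ? /eqP ?]]; [split|apply/andP; split].
move=> s t Is Jt reg.
have c1 := (regE _ _ Is Jt).1 reg.
have aa := arclength_sphere halpha Is; have bb := arclength_sphere hbeta Jt.
have a'a' := arclength_speed halpha Is; have b'b' := arclength_speed hbeta Jt.
have aa' := arclength_orth openI halpha Is.
have bb' := arclength_orth openJ hbeta Jt.
set k := c s t in c1 *; set r := Num.sqrt (1 - k ^+ 2).
have r2 : r ^+ 2 = 1 - k ^+ 2.
  rewrite sqr_sqrtr // subr_ge0 -sqrrN -(FE s t Is Jt).
  exact: dot_sqr_le1 (EE s t Is Jt) (GE s t Is Jt).
have r0 : r != 0 by rewrite -sqrf_eq0 r2 subr_eq0 eq_sym.
set P := curvature alpha s * _; set Q := curvature beta t * _.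
have eE : form_e X (N s t) s t = r^-1 * P.
  rewrite /form_e XssE // /N -/k -/r dotZr /P; congr (_ * _).
  (* The summand alpha of alpha'' + alpha adds <alpha beta, alpha' beta'> = k to <alpha'' beta,
     alpha' beta'>. The part - k alpha beta of the normal adds the same k, since <alpha'', alpha> =
     -1. *)
  rewrite (curvature_leftB openI halpha Is) // qmulDl dotDl dotDr dotNr dotZr.
  rewrite dot_qmul2r bb (arclength_acc_position openI halpha Is) /k cE.
  by rewrite (dotC (alpha s *q _)); ring.
have gE : form_g X (N s t) s t = - (r^-1 * Q).
  rewrite /form_g XttE // /N -/k -/r dotZr -mulrN /Q; congr (_ * _).
  rewrite (curvature_rightB openJ hbeta Jt) opprK qmulDr dotDl dotDr dotNr dotZr.
  rewrite dot_qmul2l aa (arclength_acc_position openJ hbeta Jt) /k cE.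
  by rewrite (dotC (alpha s *q beta t)); ring.
have fE : form_f X (N s t) s t = r.
  rewrite /form_f XstE // /N -/k -/r dotZr dotDr dotNr dotZr -cE -/k.
  rewrite dot_qmul2l a'a' b'b' mulr1 -expr2 -r2.
  by field.
rewrite /mean_curvature /gauss_curvature eE fE gE EE // GE // FE // -/k.
have d0 : 1 - k ^+ 2 != 0 by rewrite -r2 sqrf_eq0.
split.
(* The product X_s X^-1 X_t collapses to alpha' beta', which puts [N] in the form required by
   [unit_normalP]. *)
- move=> nu; rewrite /is_unit_normal (_ : N s t =
    r^-1 *: (partial_s X s t *q qconj (X s t) *q partial_t X s t - k *: X s t)).
    apply: unit_normalP; rewrite ?XsE ?XtE //.
    + by rewrite dot_qmul2l aa bb mulr1.
    + by rewrite dot_qmul2r a'a' bb mulr1.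
    + by rewrite dot_qmul2l aa b'b' mulr1.
    + by rewrite dot_qmul2r aa' mulr0.
    + by rewrite dot_qmul2l bb' mulr0.
    + by rewrite -XsE // -XtE //; exact: FE.
  rewrite /N -/k -/r XsE // XtE //; congr (_ *: (_ - _)).
  rewrite /X /translation_surface qconjM.
  by rewrite -!qmulA qmulKl_conj aa scale1r qmulKl bb scale1r.
- have -> : (1 - k ^+ 2) `^ (3 / 2) = r ^+ 3.
    rewrite mulrC powRrM powR12_sqrt -?r2 ?sqr_ge0 // r2 -/r.
    by rewrite powR_mulrn // sqrtr_ge0.
  have -> : k ^+ 2 - 1 = - r ^+ 2 by rewrite r2 opprB.
  rewrite !mulr1 sqrrN -r2.
  by field.
(* As f^2 = r^2 = E G - F^2, the term - f^2 contributes -1 and cancels the curvature 1 of the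
   sphere; what remains is e g / r^2. *)
- rewrite !mulr1 sqrrN -r2.
  by rewrite /P /Q; field.
Unshelve. all: by end_near.
Qed.
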